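(* Let $F$ be a graph with at least one edge and without isolated vertices, with $v$ vertices and $\ell$ edges. Let $g:\mathbb{Z}_{\ge 0}\to\mathbb{R}$ satisfy: (i) $g(i+j)\le g(i)+g(j)$ for all $i,j\in\mathbb{Z}_{\ge 0}$; (ii) $g(i)\le e_i$ for every $i\in\{0,1,\ldots,v-1\}$, where $e_0=0$ and $e_i=\min_{S\subset V(F),\,|S|=i}|E(F)\setminus E(F\setminus S)|-1$ for $i\ge 1$. Then, for every integer $n\ge v$, $$\mathrm{wsat}(n,F)\ \ge\ g(n-v)+\ell-1.$$
   Context: All graphs are finite and simple. Given a graph $F$, an $F$-bootstrap percolation process is a sequence of graphs $H_0\subset H_1\subset\cdots\subset H_m$ on the same vertex set such that, for each $i=1,\ldots,m$, $H_i$ is obtained from $H_{i-1}$ by adding one edge that belongs to a copy of $F$ (a not necessarily induced subgraph isomorphic to $F$) in $H_i$. A graph $H$ on $[n]=\{1,\ldots,n\}$ is weakly $F$-saturated if there is an $F$-bootstrap percolation process $H=H_0\subset\cdots\subset H_m=K_n$. The number $\mathrm{wsat}(n,F)$ is the minimum number of edges of a weakly $F$-saturated graph on $[n]$. For $S\subset V(F)$, $F\setminus S$ denotes the subgraph of $F$ induced on $V(F)\setminus S$; thus $e_i+1$ is the minimum, over $i$-element sets $S\subset V(F)$, of the number of edges of $F$ having at least one endpoint in $S$. *)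

(* Defs.v *)
From HB Require Import structures.
From mathcomp Require Import all_boot all_order all_algebra.
From mathcomp Require Import reals.

Set Implicit Arguments.
Unset Strict Implicit.
Unset Printing Implicit Defensive.

Import Order.TTheory GRing.Theory Num.Theory.
Local Open Scope ring_scope.

(* A finite simple graph with vertex set T, given by its edge set: a set of
   2-element subsets of T. *)
Record sgraph (T : finType) := SGraph {
  edges : {set {set T}};
  _ : [forall e in edges, #|e| == 2]
}.

HB.instance Definition _ (T : finType) := [isSub for @edges T].
HB.instance Definition _ (T : finType) := [Finite of sgraph T by <:].

Lemma complete_subproof (T : finType) :
  [forall e in [set e : {set T} | #|e| == 2], #|e| == 2].
Proof. by apply/forall_inP => e; rewrite inE. Qed.

Definition complete (T : finType) : sgraph T := SGraph (complete_subproof T).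

(* An injective f mapping edges of F to edges of H; the copy of F in H that it
   determines has vertex set f @: V and edges f @: a for a \in edges F. *)
Definition is_embedding (V T : finType) (F : sgraph V) (H : sgraph T)
    (f : {ffun V -> T}) : bool :=
  injectiveb f && [forall a in edges F, f @: a \in edges H].

Definition in_copy (V T : finType) (F : sgraph V) (H : sgraph T)
    (e : {set T}) : bool :=
  [exists f : {ffun V -> T},
     is_embedding F H f && [exists a in edges F, e == f @: a]].

Definition bootstrap_step (V T : finType) (F : sgraph V) : rel (sgraph T) :=
  fun H H' => [exists e : {set T},
    [&& e \notin edges H, edges H' == e |: edges H & in_copy F H' e]].

Definition weakly_saturated (V T : finType) (F : sgraph V) (H : sgraph T) :
    bool :=
  connect (bootstrap_step F) H (complete T).

Lemma weakly_saturatedP (V T : finType) (F : sgraph V) (H : sgraph T) :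
  reflect (exists2 s : seq (sgraph T),
             path (bootstrap_step F) H s & complete T = last H s)
          (weakly_saturated F H).
Proof. exact: connectP. Qed.

Lemma complete_weakly_saturated (V T : finType) (F : sgraph V) :
  weakly_saturated F (complete T).
Proof. exact: connect0. Qed.

(* complete_weakly_saturated makes this arg min a genuine minimizer. *)
Definition wsat (n : nat) (V : finType) (F : sgraph V) : nat :=
  #|edges [arg min_(H < complete 'I_n | weakly_saturated F H) #|edges H|]|.

Lemma wsat_attained (n : nat) (V : finType) (F : sgraph V) :
  exists2 H : sgraph 'I_n, weakly_saturated F H & #|edges H| = wsat n F.
Proof.
rewrite /wsat; case: arg_minnP => [|H sH _]; last by exists H.
exact: complete_weakly_saturated.
Qed.

Lemma wsat_min (n : nat) (V : finType) (F : sgraph V) (H : sgraph 'I_n) :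
  weakly_saturated F H -> (wsat n F <= #|edges H|)%N.
Proof.
rewrite /wsat; case: arg_minnP => [|H0 _ min0]; last exact: min0.
exact: complete_weakly_saturated.
Qed.

Definition no_isolated (V : finType) (F : sgraph V) : Prop :=
  forall x : V, exists2 e : {set V}, e \in edges F & x \in e.

(* The edge set of F \ S, the subgraph of F induced on the complement of S. *)
Definition edges_del (V : finType) (F : sgraph V) (S : {set V}) :
    {set {set V}} :=
  [set e in edges F | e \subset ~: S].

(* The default value #|edges F| bounds all the terms, so the iterated minn is
   the minimum over the i-element sets S as soon as i <= #|V|.  The value is an
   int so that the subtraction of 1 is not truncated. *)
Definition e_ (V : finType) (F : sgraph V) (i : nat) : int :=
  if i == 0%N then 0
  else (\big[minn/#|edges F|]_(S : {set V} | #|S| == i)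
          #|edges F :\: edges_del F S|)%N%:Z - 1.

Lemma bigminn_leq (I : finType) (P : pred I) (c : I -> nat) (m : nat) (i : I) :
  P i -> (\big[minn/m]_(j | P j) c j <= c i)%N.
Proof. by move=> Pi; rewrite -minEnat -leEnat bigmin_le_cond. Qed.

Lemma e_0 (V : finType) (F : sgraph V) : e_ F 0 = 0.
Proof. by []. Qed.

Lemma e_attained (V : finType) (F : sgraph V) (i : nat) :
  (0 < i <= #|V|)%N ->
  exists2 S : {set V}, #|S| = i &
    e_ F i = #|edges F :\: edges_del F S|%:Z - 1.
Proof.
case/andP=> i0 iV; rewrite /e_ -[i == 0%N]negbK -lt0n i0 /=.
pose c (S : {set V}) := #|edges F :\: edges_del F S|.
have cE (S : {set V}) : (c S <= #|edges F|)%N by rewrite subset_leq_card ?subsetDl.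
have [S0 S0i] : exists S : {set V}, #|S| == i.
  have : (0 < #|[set S : {set V} | #|S| == i]|)%N by rewrite card_draws bin_gt0.
  by case/card_gt0P => S; rewrite inE; exists S.
case: (@arg_minnP _ S0 (fun S => #|S| == i) c S0i) => S /eqP Si minS.
exists S => //; congr (Posz _ - 1); rewrite -/(c S).
apply/eqP; rewrite eqn_leq; apply/andP; split.
  by apply: bigminn_leq; rewrite Si.
elim/big_ind: _ => [|x y cx cy|T /minS //]; first exact: cE.
by rewrite leq_min cx.
Qed.

Lemma e_min (V : finType) (F : sgraph V) (S : {set V}) :
  (0 < #|S|)%N -> e_ F #|S| <= #|edges F :\: edges_del F S|%:Z - 1.
Proof.
move=> S0; rewrite /e_ -[_ == 0%N]negbK -lt0n S0 /= lerD2r lez_nat.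
exact: bigminn_leq.
Qed.

(* Main.v *)
Require Import Defs.
From HB Require Import structures.
From mathcomp Require Import all_boot all_order all_algebra.
From mathcomp Require Import reals.
From mathcomp Require Import perm zify lra.

Set Implicit Arguments.
Unset Strict Implicit.
Unset Printing Implicit Defensive.

Import Order.TTheory GRing.Theory Num.Theory.
Local Open Scope ring_scope.

(* Replacing g by its running maximum, which is still subadditive and still
   bounded by e_i because i |-> e_i is nondecreasing, we may assume g monotone.
   Let H be the initial graph.  Along the process we keep vertex sets U_k of
   size at least v and a set X of residual edges which together cover the
   current graph, with |X| + sum_k (g(|U_k| - v) + l - 1) <= |E(H)|.  When a copy
   of F completes an edge b0, all the U_k meeting the copy are merged with it
   into one set and the edges of the copy are dropped from X.  The merged set
   has size at most v + sum_k (|U_k| - v) + sum_k (v - a_k), where a_k is the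
   number of vertices of the copy in U_k, and g(v - a_k) is at most the number
   of edges of the copy other than b0 not inside U_k; since each of the l - 1
   edges other than b0 lies in X or in some U_k, the bound is preserved.  Once
   the graph is complete, merging along further copies makes some U_k grow to
   the whole vertex set, and its weight is then the required lower bound. *)

(** * Monotonicity of the numbers [e_ F i] *)

Lemma e_ge0 (V : finType) (F : sgraph V) (i : nat) :
  no_isolated F -> (i <= #|V|)%N -> 0 <= e_ F i.
Proof.
move=> Fiso iV; have [->|i0] := posnP i; first by rewrite e_0.
have [|S Si ->] := @e_attained V F i; first by rewrite i0.
have /card_gt0P[x xS] : (0 < #|S|)%N by rewrite Si.
have [b bF xb] := Fiso x.
suff : (0 < #|edges F :\: edges_del F S|)%N by lia.
apply/card_gt0P; exists b; rewrite !inE bF andbT.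
by apply/negP=> /subsetP/(_ x xb); rewrite inE xS.
Qed.

(** Dropping a vertex from an optimal set of size [i.+1] leaves a set that touches no more edges.
    The case [i = 0] is apart because [e_ F 0] is 0, while the general formula would give -1. *)
Lemma e_le_succ (V : finType) (F : sgraph V) (i : nat) :
  no_isolated F -> (i < #|V|)%N -> e_ F i <= e_ F i.+1.
Proof.
move=> Fiso iV; have [->|i0] := posnP i; first by rewrite e_0 e_ge0 //; lia.
have [|S Si ->] := @e_attained V F i.+1; first by rewrite iV.
have /card_gt0P[x xS] : (0 < #|S|)%N by rewrite Si.
have SxE : #|S :\ x| = i by move: (cardsD1 x S); rewrite xS Si; lia.
rewrite -SxE; apply: le_trans (e_min F _) _; first by rewrite SxE.
rewrite lerD2r lez_nat subset_leq_card //; apply/setDS/subsetP => b.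
rewrite !inE => /andP[-> /subset_trans]; apply.
by rewrite setCS subsetDl.
Qed.

Lemma e_mono (V : finType) (F : sgraph V) (i j : nat) :
  no_isolated F -> (i <= j <= #|V|)%N -> e_ F i <= e_ F j.
Proof.
move=> Fiso /andP[]; elim: j => [|j IH]; first by rewrite leqn0 => /eqP ->.
rewrite leq_eqVlt => /predU1P[-> //|ij jV].
by apply: le_trans (e_le_succ Fiso jV); apply: IH => //; apply: ltnW.
Qed.

(** * The monotone envelope of [g] *)

Definition running_max (R : realType) (g : nat -> R) (i : nat) : R :=
  \big[Num.max/0]_(j < i.+1) g j.

Lemma running_max_ge (R : realType) (g : nat -> R) (i j : nat) :
  (j <= i)%N -> g j <= running_max g i.
Proof.
rewrite -ltnS => ji.
exact: (le_bigmax_cond _ (fun k : 'I_i.+1 => g k) (j := Ordinal ji)).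
Qed.

Lemma running_max_ge0 (R : realType) (g : nat -> R) (i : nat) :
  0 <= running_max g i.
Proof. exact: bigmax_ge_id. Qed.

Lemma running_max_le (R : realType) (g : nat -> R) (i : nat) (x : R) :
  0 <= x -> (forall j : nat, (j <= i)%N -> g j <= x) -> running_max g i <= x.
Proof. by move=> x0 gx; apply: bigmax_le => // j _; apply: gx; rewrite -ltnS. Qed.

Lemma running_max_mono (R : realType) (g : nat -> R) (i j : nat) :
  (i <= j)%N -> running_max g i <= running_max g j.
Proof.
move=> ij; apply: running_max_le => [|k ki]; first exact: running_max_ge0.
exact/running_max_ge/(leq_trans ki).
Qed.

Lemma running_max_sub (R : realType) (g : nat -> R) (i j : nat) :
  (forall i j : nat, g (i + j)%N <= g i + g j) ->
  running_max g (i + j) <= running_max g i + running_max g j.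
Proof.
move=> gsub; apply: running_max_le => [|k kij].
  by rewrite addr_ge0 ?running_max_ge0.
(* The first summand is at most [i] and the second at most [j]. *)
have -> : k = (minn k i + (k - minn k i))%N by lia.
by apply: le_trans (gsub _ _) _; apply: lerD; apply: running_max_ge; lia.
Qed.

(** * A union bound, and the placing of copies of [F] *)

Lemma card_cover_seq (I T : finType) (s : seq I) (P : I -> {set T})
    (Y A : {set T}) :
  (forall a, a \in A -> a \in Y \/ exists2 i, i \in s & a \in P i) ->
  (#|A| <= #|Y| + \sum_(i <- s) #|P i|)%N.
Proof.
elim: s A => [|i s IH] A cov.
  rewrite big_nil addn0 subset_leq_card //; apply/subsetP => a /cov[//|[]//].
have /IH : forall a, a \in A :\: P i ->
    a \in Y \/ exists2 j, j \in s & a \in P j.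
  move=> a; rewrite inE => /andP[aPi /cov[|[j]]]; first by left.
  rewrite inE => /predU1P[-> /(negP aPi)//|js aPj]; by right; exists j.
rewrite big_cons -(cardsID (P i) A).
have : (#|A :&: P i| <= #|P i|)%N by rewrite subset_leq_card ?subsetIr.
lia.
Qed.

(** An arbitrary injection is corrected by two transpositions: the first sends [a] to [x], the
    second sends [b] to [y] and fixes [x]. *)
Lemma exists_inj_through (V T : finType) (a b : V) (x y : T) :
  a != b -> x != y -> (#|V| <= #|T|)%N ->
  exists f : {ffun V -> T}, [/\ injective f, f a = x & f b = y].
Proof.
move=> ab xy VT.
pose f0 (u : V) : T := enum_val (widen_ord VT (enum_rank u)).
have f0I : injective f0.
  by move=> u w /enum_val_inj [] /val_inj /enum_rank_inj.
pose p : {perm T} := tperm (f0 a) x.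
have pa : p (f0 a) = x by rewrite /p tpermL.
pose q : {perm T} := tperm (p (f0 b)) y.
exists [ffun u => q (p (f0 u))]; split.
- by move=> u w; rewrite !ffunE => /perm_inj /perm_inj /f0I.
- rewrite ffunE pa /q tpermD // 1?eq_sym //.
  by apply: contraNneq ab; rewrite -pa => /perm_inj/f0I ->.
- by rewrite ffunE /q tpermL.
Qed.

(** * Weighted covers of the graphs in the process *)

Section Certificates.

Context (R : realType) (V T : finType) (F : sgraph V) (g : nat -> R).
Hypothesis F_edge : (0 < #|edges F|)%N.
Hypothesis g0 : g 0 = 0.
Hypothesis g_mono : forall i j : nat, (i <= j)%N -> g i <= g j.
Hypothesis g_sub : forall i j : nat, g (i + j)%N <= g i + g j.
Hypothesis g_le : forall i : nat, (i < #|V|)%N -> g i <= (e_ F i)%:~R.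

(** The natural subtraction is not truncated on the sets of a certificate, which have at least
    [#|V|] points. *)
Let weight (U : {set T}) : R := g (#|U| - #|V|)%N + #|edges F|%:R - 1.

Definition copy_edges (f : {ffun V -> T}) : {set {set T}} :=
  [set f @: a | a : {set V} in edges F].

(** [s] lists the sets U_k and [X] holds the residual edges; [c] is the number of edges of the
    initial graph and stays fixed while [H] grows. *)
Definition certificate (s : seq {set T}) (X H : {set {set T}}) (c : R) : Prop :=
  [/\ all (fun U : {set T} => #|V| <= #|U|)%N s,
      forall b, b \in H -> b \in X \/ exists2 U : {set T}, U \in s & b \subset U
    & #|X|%:R + \sum_(U <- s) weight U <= c].

Lemma g_ge0 i : 0 <= g i.
Proof. by rewrite -g0 g_mono. Qed.

Lemma weight_ge0 U : 0 <= weight U.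
Proof.
by rewrite /weight -addrA addr_ge0 ?g_ge0 // subr_ge0 ler1n.
Qed.

Lemma card_copy_edges (f : {ffun V -> T}) :
  injective f -> #|copy_edges f| = #|edges F|.
Proof. by move=> fI; rewrite card_imset //; apply: imset_inj. Qed.

(* The edge b0 makes up for the -1 in the definition of e_i; when the copy lies
   inside U both sides vanish. *)
Lemma g_outside_le (f : {ffun V -> T}) (b0 U : {set T}) :
  injective f -> b0 \in copy_edges f -> U :&: f @: V != set0 ->
  g (#|V| - #|U :&: f @: V|)%N
    <= #|[set b in copy_edges f :\ b0 | ~~ (b \subset U)]|%:R.
Proof.
(* [S] consists of the vertices of [F] sent outside [U], so the edges of [F] touching [S] are those
   whose image is not inside [U]. *)
move=> fI b0f Uf; pose S := ~: (f @^-1: U).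
have SE : (#|V| - #|U :&: f @: V|)%N = #|S|.
  have -> : U :&: f @: V = f @: (f @^-1: U).
    apply/setP=> x; apply/setIP/imsetP => [[xU /imsetP[u _ xE]]|[u uU ->]].
      by exists u; rewrite ?inE -?xE.
    by rewrite inE in uU; rewrite imset_f.
  by rewrite card_imset // -(cardsC (f @^-1: U)) addKn.
rewrite SE; have [->|S0] := posnP #|S|; first by rewrite g0 ler0n.
(* Since the copy meets [U], [S] is a proper subset, within the range of the hypothesis on [g]. *)
have SV : (#|S| < #|V|)%N.
  rewrite -SE -card_gt0 in S0 Uf *; lia.
apply: le_trans (g_le SV) _.
apply: (@le_trans _ _ ((#|edges F :\: edges_del F S|%:Z - 1)%:~R)).
  by rewrite ler_int e_min.
rewrite -[X in _ <= X]/(_%:Z%:~R) ler_int.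
have -> : #|edges F :\: edges_del F S|
    = #|[set b in copy_edges f | ~~ (b \subset U)]|.
  rewrite -(card_imset _ (imset_inj fI)); apply: eq_card => b.
  apply/imsetP/idP => [[a]|].
    rewrite !inE setCK => /andP[aS aF] ->; rewrite imset_f //=.
    by rewrite sub_imset_pre; move: aS; rewrite aF.
  rewrite inE => /andP[/imsetP[a aF ->] aU]; exists a => //.
  by rewrite !inE setCK aF -sub_imset_pre aU.
rewrite (cardsD1 b0 [set b in copy_edges f | ~~ (b \subset U)]).
have -> : [set b in copy_edges f | ~~ (b \subset U)] :\ b0
    = [set b in copy_edges f :\ b0 | ~~ (b \subset U)].
  by apply/setP=> b; rewrite !inE andbA.
by rewrite lerBlDr -[1]/(1%:Z) -PoszD lez_nat addnC leq_add2l leq_b1.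
Qed.

(** The sets are joined to the copy one at a time. The union [W] built so far contains the copy, so
    it shares with the next [U] at least the a vertices of the copy in [U]; hence the excess over v
    grows by at most (|U| - v) + (v - a), and subadditivity splits [g]. *)
Lemma g_merge_le (f : {ffun V -> T}) (b0 : {set T}) (s : seq {set T}) :
  injective f -> b0 \in copy_edges f ->
  all (fun U : {set T} => (#|V| <= #|U|)%N && (U :&: f @: V != set0)) s ->
  g (#|f @: V :|: \bigcup_(U <- s) U| - #|V|)%N
    <= \sum_(U <- s) (g (#|U| - #|V|)%N
         + #|[set b in copy_edges f :\ b0 | ~~ (b \subset U)]|%:R).
Proof.
move=> fI b0f; have fV : #|f @: V| = #|V| by rewrite card_imset.
elim: s => [|U s IH] /=; first by rewrite !big_nil setU0 fV subnn g0.
case/andP=> /andP[UV Uf] /IH {IH}; rewrite !big_cons.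
set W := f @: V :|: \bigcup_(U <- s) U => IH.
rewrite setUCA -/W; have VW : (#|V| <= #|W|)%N.
  by rewrite -fV subset_leq_card ?subsetUl.
have UW : (#|U :&: f @: V| <= #|U :&: W|)%N.
  by rewrite subset_leq_card ?setIS ?subsetUl.
have UfV : (#|U :&: f @: V| <= #|V|)%N by rewrite -fV subset_leq_card ?subsetIr.
have cU := cardsUI U W.
apply: (@le_trans _ _ (g ((#|U| - #|V|)
    + (#|V| - #|U :&: f @: V|) + (#|W| - #|V|))%N)).
  have arith (u w r i a v : nat) : (v <= u)%N -> (v <= w)%N -> (a <= i)%N ->
      (a <= v)%N -> (r + i = u + w)%N -> (r - v <= (u - v) + (v - a) + (w - v))%N.
    by lia.
  exact/g_mono/(arith _ _ _ _ _ _ UV VW UW UfV cU).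
apply: le_trans (g_sub _ _) _; apply: lerD IH.
apply: le_trans (g_sub _ _) _; rewrite lerD2l.
exact: g_outside_le.
Qed.

(** [b0] may already belong to [H], so the lemma also serves for merging inside the complete graph;
    there the last conclusion makes a chosen set grow. *)
Lemma certificate_step (f : {ffun V -> T}) (b0 : {set T}) s X
    (H : {set {set T}}) (c : R) :
  injective f -> b0 \in copy_edges f -> copy_edges f :\ b0 \subset H ->
  certificate s X H c ->
  exists s' X' (U : {set T}), [/\ certificate s' X' (b0 |: H) c, U \in s', f @: V \subset U
    & forall W : {set T}, W \in s -> W :&: f @: V != set0 -> W \subset U].
Proof.
move=> fI b0f /subsetP fH [sV cov cost].
pose meets (U : {set T}) := U :&: f @: V != set0.
pose J := [seq U <- s | meets U]; pose K := [seq U <- s | ~~ meets U].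
pose U' := f @: V :|: \bigcup_(U <- J) U.
have fU' : f @: V \subset U' by exact: subsetUl.
have JU' W : W \in s -> meets W -> W \subset U'.
  move=> Ws Wm; apply: subset_trans (subsetUr _ _).
  by rewrite (big_rem W) ?subsetUl // mem_filter Wm.
have copyU b : b \in copy_edges f -> b \subset U'.
  by case/imsetP=> a _ ->; apply: subset_trans fU'; apply/imsetS/subset_predT.
exists (U' :: K), (X :\: copy_edges f), U'.
split=> //; last by rewrite mem_head.
have fV : #|f @: V| = #|V| by rewrite card_imset.
split.
- apply/andP; split; first by rewrite -fV subset_leq_card.
  by apply/allP=> U; rewrite mem_filter => /andP[_ /(allP sV)].
- move=> b; have [/copyU bU' _|bf] := boolP (b \in copy_edges f).
    by right; exists U'; rewrite ?mem_head.
  have bb0 : b != b0 by apply: contraNneq bf => ->.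
  rewrite in_setU1 (negPf bb0) /= => /cov[bX|[U Us bU]].
    by left; rewrite inE bf.
  right; have [Um|Um] := boolP (meets U).
    by exists U'; rewrite ?mem_head ?(subset_trans bU) ?JU'.
  by exists U; rewrite // in_cons mem_filter Um Us orbT.
- pose D := copy_edges f :\ b0.
  pose inn (U : {set T}) := [set b in D | b \subset U].
  pose out (U : {set T}) := [set b in D | ~~ (b \subset U)].
  have DE : #|edges F| = #|D|.+1 by rewrite -(card_copy_edges fI) (cardsD1 b0) b0f.
  (* A set containing an edge of the copy meets the copy, as edges are nonempty; so the merged sets
     and [X] alone cover [D]. *)
  have covD : (#|D| <= #|X :&: copy_edges f| + \sum_(U <- J) #|inn U|)%N.
    apply: card_cover_seq => b bD; have bf : b \in copy_edges f.
      by move: bD; rewrite inE => /andP[].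
    have [bX|[U Us bU]] := cov b (fH b bD); first by left; rewrite inE bX.
    right; exists U; last by rewrite inE bD.
    rewrite mem_filter Us andbT; case/imsetP: bf bU => a aF ->.
    have /card_gt0P[u ua] : (0 < #|a|)%N.
      by rewrite (eqP (forall_inP (valP F) a aF)).
    move/subsetP/(_ (f u) (imset_f f ua)) => fuU.
    by apply/set0Pn; exists (f u); rewrite inE fuU imset_f.
  have inout U : (#|inn U| + #|out U| = #|D|)%N.
    rewrite -(cardsID [set b : {set T} | b \subset U] D).
    by congr (_ + _)%N; apply: eq_card => b; rewrite !inE // andbC.
  have gU' : g (#|U'| - #|V|)%N
      <= \sum_(U <- J) (g (#|U| - #|V|)%N + #|out U|%:R).
    apply: g_merge_le => //; apply/allP => U.
    by rewrite mem_filter => /andP[Um /(allP sV) UV]; rewrite UV.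
  have weightE U : weight U = g (#|U| - #|V|)%N + #|D|%:R.
    by rewrite /weight DE -natr1 addrA addrK.
  have sumJ : \sum_(U <- J) weight U
      = \sum_(U <- J) (g (#|U| - #|V|)%N + #|out U|%:R)
        + (\sum_(U <- J) #|inn U|)%N%:R.
    rewrite natr_sum -big_split; apply: eq_bigr => U _ /=.
    by rewrite weightE -(inout U) natrD; lra.
  have sumJK : \sum_(U <- s) weight U
      = \sum_(U <- J) weight U + \sum_(U <- K) weight U.
    by rewrite !big_filter (bigID meets).
  have cX : #|X|%:R = #|X :&: copy_edges f|%:R + #|X :\: copy_edges f|%:R :> R.
    by rewrite -natrD cardsID.
  (* The new set weighs [g] of its excess plus [#|D|]. The first term is paid by the [g] and [out]
     parts of the merged sets, the second by their [inn] parts and the edges dropped from [X]. *)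
  move: covD; rewrite -(ler_nat R) natrD => covD.
  rewrite big_cons weightE; lra.
Qed.

(* A set U is enlarged by a copy that meets both U and its complement. *)
Lemma complete_certificate_bound s X c :
  (#|V| <= #|T|)%N -> certificate s X (edges (complete T)) c ->
  g (#|T| - #|V|)%N + #|edges F|%:R - 1 <= c.
Proof.
move=> VT cert.
have /card_gt0P[a0 a0F] := F_edge.
have a02 : #|a0| = 2 by apply/eqP/(forall_inP (valP F)).
have [a [b [_ _ ab]]] : exists a b, [/\ a \in a0, b \in a0 & a != b].
  by apply/card_gt1P; rewrite a02.
have step (f : {ffun V -> T}) s1 X1 : injective f ->
    certificate s1 X1 (edges (complete T)) c ->
    exists s2 X2 (U : {set T}), [/\ certificate s2 X2 (edges (complete T)) c, U \in s2,
      f @: V \subset U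
      & forall W : {set T}, W \in s1 -> W :&: f @: V != set0 -> W \subset U].
  move=> fI cert1.
  have copyT b1 : b1 \in copy_edges f -> b1 \in edges (complete T).
    case/imsetP=> a1 a1F ->; rewrite inE card_imset //.
    exact: (forall_inP (valP F)).
  have b0f : f @: a0 \in copy_edges f by apply: imset_f.
  have [|s2 [X2 [U [cert2 Us2 fU sU]]]] := certificate_step fI b0f _ cert1.
    by apply/subsetP=> b1; rewrite inE => /andP[_ /copyT].
  exists s2, X2, U; split=> //; move: cert2.
  by rewrite (setUidPr _) // sub1set copyT.
have grow k : (k <= #|T|)%N -> exists s1 X1 (U : {set T}),
    [/\ certificate s1 X1 (edges (complete T)) c, U \in s1, U != set0
      & (k <= #|U|)%N].
  elim: k => [|k IH] kT.
    (* The given list may be empty; a copy placed anywhere provides a first nonempty set. *)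
    have /card_gt1P[x [y [_ _ xy]]] : (1 < #|T|)%N.
      by apply: leq_trans VT; move: (max_card (mem a0)); rewrite a02.
    have [f [fI fa _]] := exists_inj_through ab xy VT.
    have [s1 [X1 [U [cert1 Us1 fU _]]]] := step f s X fI cert.
    exists s1, X1, U; split=> //; apply/set0Pn; exists x.
    by rewrite -fa (subsetP fU) ?imset_f.
  have [s1 [X1 [U [cert1 Us1 U0 kU]]]] := IH (ltnW kT).
  have [kU'|] := ltnP k #|U|; first by exists s1, X1, U.
  move=> Uk; have /set0Pn[y yU] := U0.
  have /card_gt0P[x] : (0 < #|~: U|)%N by rewrite cardsCs setCK subn_gt0; lia.
  rewrite inE => xU; have xy : x != y by apply: contraNneq xU => ->.
  have [f [fI fa fb]] := exists_inj_through ab xy VT.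
  have [s2 [X2 [W [cert2 Ws2 fW sW]]]] := step f s1 X1 fI cert1.
  have UW : U \subset W.
    by apply: sW => //; apply/set0Pn; exists y; rewrite inE yU -fb imset_f.
  exists s2, X2, W; split=> //.
    by apply/set0Pn; exists y; apply: (subsetP UW).
  apply: leq_ltn_trans kU _; apply: proper_card; rewrite properE UW.
  apply/subsetPn; exists x => //.
  by rewrite (subsetP fW) // -fa imset_f.
have [s1 [X1 [U [[_ _ cost] Us1 _ TU]]]] := grow #|T| (leqnn _).
have UE : #|U| = #|T| by apply/eqP; rewrite eqn_leq TU max_card.
(* The weight of the full vertex set is one term of the cost, and the other terms are
   nonnegative. *)
apply: le_trans cost; rewrite (big_rem U) //= {1}/weight UE.
have := @sumr_ge0 R _ (rem U s1) predT weight (fun W _ => weight_ge0 W).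
by have := ler0n R #|X1|; lra.
Qed.

Lemma certificate_path (H : sgraph T) (p : seq (sgraph T)) s X c :
  path (bootstrap_step F) H p -> certificate s X (edges H) c ->
  exists s' X', certificate s' X' (edges (last H p)) c.
Proof.
elim: p H s X => [|H' p IH] H s X /=; first by exists s, X.
case/andP=> /existsP[e /and3P[eH /eqP H'E copy_e]] /IH {}IH cert.
case/existsP: copy_e => f /andP[/andP[/injectiveP fI /forall_inP fH']].
case/exists_inP=> a aF /eqP eE.
have ef : e \in copy_edges f by rewrite eE imset_f.
have [|s' [X' [_ [cert' _ _ _]]]] := certificate_step fI ef _ cert.
  (* The copy lies in [H'], whose only new edge is [e], so its other edges are already in [H]. *)
  apply/subsetP=> b; rewrite in_setD1 => /andP[be /imsetP[a' a'F bE]].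
  by have := fH' _ a'F; rewrite -bE H'E in_setU1 (negPf be).
by apply: (IH s' X'); rewrite H'E.
Qed.

Lemma weakly_saturated_bound (H : sgraph T) :
  (#|V| <= #|T|)%N -> weakly_saturated F H ->
  g (#|T| - #|V|)%N + #|edges F|%:R - 1 <= #|edges H|%:R.
Proof.
move=> VT /weakly_saturatedP[p Hp lastE].
(* At the start there are no sets and every edge is residual. *)
have cert : certificate [::] (edges H) (edges H) #|edges H|%:R.
  by split=> // [b|]; [left | rewrite big_nil addr0].
have [s [X]] := certificate_path Hp cert; rewrite -lastE.
exact: complete_certificate_bound.
Qed.

End Certificates.

(** * Passage from [g] to its running maximum *)

Theorem theorem2p1 (R : realType) (V : finType) (F : sgraph V)
    (F_edge : (0 < #|edges F|)%N) (F_iso : no_isolated F)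
    (g : nat -> R)
    (g_sub : forall i j : nat, g (i + j)%N <= g i + g j)
    (g_le : forall i : nat, (i < #|V|)%N -> g i <= (e_ F i)%:~R)
    (n : nat) (n_ge : (#|V| <= n)%N) :
  g (n - #|V|)%N + #|edges F|%:R - 1 <= (wsat n F)%:R.
Proof.
have [H Hsat <-] := wsat_attained n F.
have /card_gt0P[a /(forall_inP (valP F)) a2] := F_edge.
have V0 : (0 < #|V|)%N.
  by apply: leq_trans (max_card (mem a)); rewrite (eqP a2).
pose G := running_max g.
have G_le i : (i < #|V|)%N -> G i <= (e_ F i)%:~R.
  move=> iV; apply: running_max_le => [|j ji].
    by rewrite ler0z e_ge0 // ltnW.
  apply: le_trans (g_le _ (leq_ltn_trans ji iV)) _.
  by rewrite ler_int e_mono // ji ltnW.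
(* The default 0 of the maximum gives one inequality and [e_ F 0 = 0] the other. *)
have G0 : G 0 = 0.
  by apply/le_anti; rewrite running_max_ge0 -[X in _ <= X](mulr0z 1) G_le.
have cardT : #|'I_n| = n by apply: card_ord.
have := @weakly_saturated_bound R V 'I_n F G F_edge G0
  (@running_max_mono R g) (fun i j => running_max_sub i j g_sub) G_le H.
rewrite cardT => /(_ n_ge Hsat); apply: le_trans.
by rewrite -!addrA lerD2r running_max_ge.
Qed.
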